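(* Let $z_1\in\mathbb{C}$, $K\in\mathbb{R}$, $K_s>0$ be given, and consider the velocity field $v_{z_1}(\theta)=-K|z_1|\sin(\angle z_1-\theta)-K_s\sin(2\theta)$ on $\mathbb{T}$. Let $\{\zeta_i\}\subset\mathbb{T}$ denote its (finite) zero set. Then: (1) There exists a probability measure $\rho$ on $\mathbb{T}$ such that $v_{z_1}\rho=0$ and $z_1=z_1(\rho)$ if and only if $z_1$ lies in the convex hull of the zero set of $v_{z_1}$ (regarded as a subset of $\mathbb{C}$). (2) Supposing (1) holds, every such $\rho$ has the form $\rho=\sum_i m_i\delta_{\zeta_i}$ for some coefficients $m_i\ge0$ with $\sum_i m_i=1$ and $z_1=\sum_i m_i\zeta_i$ (with the $\zeta_i$ regarded as complex numbers).
   Context: $\mathbb{T}=\mathbb{R}/2\pi\mathbb{Z}$ is identified with the unit circle in $\mathbb{C}$ via $\theta\mapsto e^{i\theta}$; in convex hulls and in $z_1=\sum_i m_i\zeta_i$, the points $\zeta_i$ are regarded as unit complex numbers under this identification. $\angle z_1$ is the argument of $z_1$ (arbitrary if $z_1=0$). For a probability measure $\rho$ on $\mathbb{T}$, the first order parameter is $z_1(\rho)=\int_{\mathbb{T}}e^{i\theta}\,\mathrm{d}\rho(\theta)$. The condition $v_{z_1}\rho=0$ means that $\rho$ is supported on the zero set of $v_{z_1}$. $\delta_\zeta$ is the Dirac mass at $\zeta$. *)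

(* Defs.v *)
From HB Require Import structures.
From mathcomp Require Import all_boot all_order all_algebra.
From mathcomp Require Import all_classical all_reals all_analysis.
From mathcomp Require Import complex.
Set Implicit Arguments.
Unset Strict Implicit.
Unset Printing Implicit Defensive.
Import Order.TTheory GRing.Theory Num.Theory.
Import numFieldNormedType.Exports.
Local Open Scope classical_set_scope.
Local Open Scope ring_scope.
Local Open Scope quotient_scope.

Definition twopiZ (R : realType) : {pred R} :=
  [pred x | x / (pi *+ 2) \is a Num.int].

Lemma twopiZ_zmod_closed (R : realType) : zmod_closed (@twopiZ R).
Proof.
split=> [|x y]; rewrite !inE; first by rewrite mul0r int_num0.
by move=> hx hy; rewrite mulrBl rpredB.
Qed.

HB.instance Definition _ (R : realType) :=
  GRing.isZmodClosed.Build R (@twopiZ R) (@twopiZ_zmod_closed R).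

(* The circle R / 2 pi Z, with the quotient topology and its Borel sets. *)
Definition circle (R : realType) : Type :=
  quotient_topology (Quotient.quot (@twopiZ R)).

HB.instance Definition _ (R : realType) := Quotient.on (circle R).
HB.instance Definition _ (R : realType) := PointedTopological.on (circle R).

Definition circle_display (R : realType) : measure_display :=
  sigma_display (@open (circle R)).

HB.instance Definition _ (R : realType) :=
  @isMeasurable.Build (circle_display R) (circle R) <<s @open (circle R) >>
    (@sigma_algebra0 _ setT (@open (circle R)))
    (@sigma_algebraC (circle R) (@open (circle R)))
    (@sigma_algebra_bigcup _ setT (@open (circle R))).

(* A function of the angle, read on the circle. It is evaluated at a chosen
   representative, so it is meaningful only for 2 pi-periodic f. *)
Definition on_circle (R : realType) (U : Type) (f : R -> U) : circle R -> U :=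
  f \o repr.

Lemma on_circleE (R : realType) (U : zmodType) (f : R -> U) :
  periodic f (pi *+ 2) -> forall t, on_circle f (\pi_(circle R) t) = f t.
Proof.
move=> fp t; rewrite /on_circle /=.
have fn (n : nat) a : f (a + (pi *+ 2) *+ n) = f a by exact: periodicn.
have : repr (\pi_(circle R) t) = t %[mod Quotient.quot (@twopiZ R)] by exact: reprK.
move=> /eqP; rewrite eqmodE /= Quotient.equivE inE => /intrP[k hk].
have p0 : (pi *+ 2 : R) != 0 by rewrite mulrn_eq0 /= gt_eqF ?pi_gt0.
have -> : repr (\pi_(circle R) t) = t + (pi *+ 2) *~ k.
  by rewrite -mulrzl -hk divfK // addrC subrK.
case: k {hk} => n; first exact: fn.
by rewrite NegzE mulrNz -[LHS](fn n.+1) subrK.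
Qed.

Definition cis (R : realType) (t : R) : Rcomplex R := (cos t +i* sin t)%C.

(* Every a is an argument of 0. *)
Definition is_arg (R : realType) (z : Rcomplex R) (a : R) : Prop :=
  z = `|z| *: cis a.

Definition velocity (R : realType) (z : Rcomplex R) (a K Ks t : R) : R :=
  - K * `|z| * sin (a - t) - Ks * sin (2 * t).

Lemma periodic_cis (R : realType) : periodic (@cis R) (pi *+ 2).
Proof. by move=> t; rewrite /cis cosD2pi sinD2pi. Qed.

Lemma periodic_velocity (R : realType) (z : Rcomplex R) (a K Ks : R) :
  periodic (velocity z a K Ks) (pi *+ 2).
Proof.
move=> t; rewrite /velocity; congr (_ * _ - _ * _).
  by rewrite opprD addrA -[LHS]sinD2pi subrK.
by rewrite mulrDr mulr_natl [2 * _]mulr_natl mulr2n addrA !sinD2pi.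
Qed.

Definition zero_set (R : realType) (z : Rcomplex R) (a K Ks : R) :
    set (circle R) :=
  [set zeta | on_circle (velocity z a K Ks) zeta = 0].

Definition order_parameter (R : realType)
    (rho : probability (circle R) R) : Rcomplex R :=
  ((\int[rho]_zeta complex.Re (on_circle (@cis R) zeta)) +i*
   (\int[rho]_zeta complex.Im (on_circle (@cis R) zeta)))%C.

Definition supported_on (R : realType) (rho : probability (circle R) R)
    (A : set (circle R)) : Prop :=
  rho.-negligible (~` A).

Definition convex_hull (R : numDomainType) (M : lmodType R) (S : set M) :
    set M :=
  \bigcap_(A in [set A : set M | convex_set A /\ S `<=` A]) A.

(* Main.v *)
(** With [c = cos t] and [s = sin t], the zeros of the velocity are given by
    [A c = s (2 Ks c - B)]; squaring and using [s^2 = 1 - c^2] gives a quartic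
    equation in [c] with leading coefficient [- 4 Ks^2], so there are finitely
    many zeros. A probability carried by a finite set of points (singletons of
    the circle are Borel) is the sum of its atoms, so its order parameter is the
    convex combination of the atoms with their masses as weights, and conversely
    any such weights define a probability. *)
Require Import Defs.
From HB Require Import structures.
From mathcomp Require Import all_boot all_order all_algebra.
From mathcomp Require Import all_classical all_reals all_analysis.
From mathcomp Require Import finmap measurable_realfun complex ring lra.
Set Implicit Arguments.
Unset Strict Implicit.
Unset Printing Implicit Defensive.
Import Order.TTheory GRing.Theory Num.Theory.
Import numFieldNormedType.Exports.
Local Open Scope classical_set_scope.
Local Open Scope ring_scope.

Lemma periodicz (U V : zmodType) (f : U -> V) (T : U) :
  periodic f T -> forall (k : int) a, f (a + T *~ k) = f a.
Proof.
move=> fT [n|n] a; first exact: periodicn.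
by rewrite NegzE mulrNz -[LHS](periodicn fT n.+1) subrK.
Qed.

(** * Separating points of the circle by cosine and sine *)

Section circle.
Variable R : realType.
Local Open Scope quotient_scope.

(** Removing whole periods leaves [r] in [[0, 2 pi)]. Since [cos r = 1 - 2 sin^2 (r / 2)], the sine
    vanishes at [r / 2], which lies in [[0, pi)]; hence [r = 0]. *)
Lemma cos_eq1_twopiZ (t : R) : cos t = 1 -> t \in @twopiZ R.
Proof.
have pi2_gt0 : 0 < pi *+ 2 :> R by rewrite mulrn_wgt0 ?pi_gt0.
pose k := Num.floor (t / (pi *+ 2)); pose r := t - (pi *+ 2) *~ k.
have tE : t = r + (pi *+ 2) *~ k by rewrite subrK.
have r_ge0 : 0 <= r.
  by rewrite subr_ge0 -mulrzl -ler_pdivlMr // floor_le.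
have r_lt : r < pi *+ 2.
  rewrite ltrBlDr -mulrzl -[X in X + _]mul1r -mulrDl -ltr_pdivrMr //.
  by rewrite addrC -[1]/(1%:~R) -intrD floorD1_gt.
rewrite tE (periodicz (@cosD2pi R)) => cosr.
have rE : r = (r / 2) *+ 2 by lra.
have sinr : sin (r / 2) = 0.
  move: cosr; rewrite [X in cos X]rE cos_mulr2n cos2sin2 => h.
  by apply/eqP; rewrite -sqrf_eq0; apply/eqP; lra.
have r0 : r = 0.
  apply/eqP; rewrite eq_le r_ge0 andbT leNgt; apply/negP => r_gt0.
  have /sin_gt0_pi : 0 < r / 2 < pi by apply/andP; split; lra.
  by rewrite sinr ltxx.
by rewrite r0 add0r inE -mulrzl mulfK ?gt_eqF.
Qed.

(** For representatives with equal cosines and sines, the cosine of their difference is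
    [cos^2 + sin^2 = 1], so they differ by a multiple of [2 pi]. *)
Lemma on_circle_cis_inj : injective (on_circle (@cis R)).
Proof.
move=> a b; rewrite /on_circle /= /cis => -[ec es].
have /eqP rab : repr a == repr b %[mod Quotient.quot (@twopiZ R)].
  rewrite eqmodE /= Quotient.equivE /=; apply: cos_eq1_twopiZ.
  by rewrite cosB ec es -!expr2 cos2Dsin2.
by rewrite -[a]reprK -[b]reprK.
Qed.

End circle.

Lemma finite_roots (R : idomainType) (p : {poly R}) :
  p != 0 -> finite_set [set x | root p x].
Proof.
move=> p0; apply: contrapT => /(infinite_set_fset (size p))[C Csub leC].
have := max_poly_roots p0 _ (fset_uniq C).
rewrite ltnNge leC => h; apply: (notF (h _)).
by apply/allP => x xC; apply: Csub.
Qed.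

Section zeros.
Variables (R : realType) (z : Rcomplex R) (a K Ks : R).

Lemma finite_zero_set : 0 < Ks -> finite_set (zero_set z a K Ks).
Proof.
move=> Ks0.
pose A := - K * `|z| * sin a; pose B := K * `|z| * cos a.
(* Coefficients, constant term first, of [(1 - x^2) (2 Ks x - B)^2 - A^2 x^2]. *)
pose p := Poly [:: B ^+ 2; - (4 * Ks * B); 4 * Ks ^+ 2 - B ^+ 2 - A ^+ 2;
                   4 * Ks * B; - (4 * Ks ^+ 2)].
have p0 : p != 0.
  apply/eqP => /(congr1 (fun q : {poly R} => q`_4)).
  rewrite coef_Poly coef0 /= => /eqP.
  by rewrite oppr_eq0 mulf_eq0 sqrf_eq0 (gt_eqF Ks0) orbF pnatr_eq0.
pose C := [set x | root p x].
have Cfin : finite_set C by exact: finite_roots.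
pose f x := Num.sqrt (1 - x ^+ 2) : R.
(* Once the cosine is one of finitely many roots, the sine is determined up to sign; the pair then
   determines the point of the circle. *)
pose S := f @` C `|` (fun x => - f x) @` C.
have Sfin : finite_set S by rewrite finite_setU; split; exact: finite_image.
have key : zero_set z a K Ks `<=`
    (fun zeta => (on_circle (@cos R) zeta, on_circle (@sin R) zeta)) @^-1`
      (C `*` S).
  move=> zeta; rewrite /zero_set /= /on_circle /= /velocity => h.
  set t := repr zeta in h *.
  have cs := cos2Dsin2 t.
  have tC : C (cos t).
    rewrite /C /= /root horner_Poly /= -/A -/B.
    have e : A * cos t + B * sin t = 2 * Ks * sin t * cos t.
      move: h; rewrite mulr_natl sin_mulr2n sinB /A /B; lra.
    have : (1 - cos t ^+ 2) * (2 * Ks * cos t - B) ^+ 2 = (A * cos t) ^+ 2.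
      rewrite -sin2cos2.
      have -> : A * cos t = sin t * (2 * Ks * cos t - B) by lra.
      by rewrite exprMn.
    move=> e2; apply/eqP; lra.
  split=> //=.
  have : f (cos t) = `|sin t| by rewrite /f -sin2cos2 sqrtr_sqr.
  case: (ler0P (sin t)) => _ e; [right|left]; exists (cos t) => //.
    by rewrite e opprK.
apply: sub_finite_set key _; apply: finite_preimage; last exact: finite_setX.
move=> x y _ _ [ex ey]; apply: on_circle_cis_inj.
by rewrite /on_circle /= /cis; move: ex ey; rewrite /on_circle /= => -> ->.
Qed.

End zeros.

(** * Measures carried by a finite set *)

Section finite_support.
Local Open Scope ereal_scope.
Context d (T : measurableType d) (R : realType).
Hypothesis measurable_set1 : forall t : T, measurable [set t].
Variable Z : set T.
Hypothesis Zfin : finite_set Z.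

Let mZ : measurable Z.
Proof. exact/countable_measurable/finite_set_countable. Qed.

(** Only [A] intersected with [Z] has mass, and it is a finite disjoint union of pieces that are
    each a singleton or empty. *)
Lemma finite_support_measureE (mu : {measure set T -> \bar R}) :
  mu.-negligible (~` Z) -> forall A, measurable A ->
  mu A = \sum_(t \in Z) mu [set t] * \d_t A.
Proof.
move=> mu0 A mA.
have muZ : mu (~` Z) = 0 by apply/negligibleP => //; exact: measurableC.
have -> : mu A = mu (A `&` Z).
  rewrite -[in LHS](setIT A) -(setUv Z) setIUr measureU; last 3 first.
  - exact: measurableI.
  - by apply: measurableI => //; exact: measurableC.
  - by rewrite setIACA setICr setI0.
  rewrite [X in _ + X](_ : _ = 0) ?adde0//.
  by apply: (subset_measure0 _ _ _ muZ) => //;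
    [apply: measurableI => //; exact: measurableC | exact: measurableC].
have -> : A `&` Z = \big[setU/set0]_(t \in Z) (A `&` [set t]).
  by rewrite fsbig_setU // -setI_bigcupr -fsbig_setU // fsbig_setU_set1.
rewrite measure_fsbig //; last 2 first.
- by move=> t _; exact: measurableI.
- by move=> s t _ _ [x [[_ ->] [_ ->]]].
apply: eq_fsbigr => t _; rewrite diracE.
have [tA|tA] := boolP (t \in A).
  rewrite mule1; congr (mu _); apply/seteqP; split=> [x []//|x /= ->].
  by split=> //; exact: set_mem.
rewrite mule0 (_ : _ `&` _ = set0) ?measure0//.
apply/seteqP; split=> [x [Ax xt]|//]; move/negP: tA; apply.
by apply/mem_set; rewrite -xt.
Qed.

Lemma finite_support_integral (mu : {finite_measure set T -> \bar R})
    (f : T -> R) :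
  mu.-negligible (~` Z) -> measurable_fun setT f ->
  (\int[mu]_t f t = \sum_(t \in Z) fine (mu [set t]) * f t)%R.
Proof.
move=> mu0 mf; rewrite /Rintegral.
(* This simple function agrees with [f] on [Z], hence almost everywhere, and can be integrated term
   by term. *)
pose h t := \sum_(s <- (fset_set Z : seq T)) (f s)%:E * (\1_[set s] t)%:E.
have ih s : mu.-integrable setT (fun t => (\1_[set s] t : R)%:E).
  exact: integrable_indic.
have ifs s : mu.-integrable setT (fun t => (f s)%:E * (\1_[set s] t : R)%:E).
  exact: integrableZl.
rewrite (ae_eq_integral h) //; last 3 first.
- exact/measurable_EFinP.
- by apply: (measurable_int mu); exact: integrable_sum.
- apply: negligibleS mu0 => t; apply: contra_not => Zt _; rewrite /h.
  rewrite -fsbig_finite // (fsbigD1 t) //= indicE in_set1 eqxx mule1.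
  rewrite fsbig1 ?adde0// => s [_ /= /eqP st].
  by rewrite indicE in_set1 eq_sym (negbTE st) mule0.
rewrite integral_sum // fsbig_finite //= big_seq [in RHS]big_seq.
have H s : \int[mu]_t ((f s)%:E * (\1_[set s] t)%:E) =
   (fine (mu [set s]) * f s)%:E.
  rewrite integralZl // integral_indic // setIT muleC EFinM fineK //.
  exact: fin_num_measure.
under eq_bigr do rewrite H.
by rewrite sumEFin.
Qed.

Lemma probability_of_weights (m : T -> R) :
  (forall t, Z t -> (0 <= m t)%R) -> (\sum_(t \in Z) m t = 1)%R ->
  exists P : probability T R, P (~` Z) = 0 /\
    forall t, Z t -> P [set t] = (m t)%:E.
Proof.
move=> m0 m1.
pose s := fset_set Z : seq T.
(* [mscale] needs a nonnegative scalar at every index, whereas [m] is only known to be nonnegative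
   on [Z]. The absolute value is harmless for indices below [size s], the only ones summed. *)
pose w n : {nonneg R} := NngNum (normr_ge0 (m (nth point s n))).
pose mu := msum (fun n => mscale (w n) (\d_(nth point s n))) (size s).
have muE A : mu A = \sum_(t \in Z) (m t)%:E * \d_t A.
  rewrite fsbig_finite // (big_nth point) big_mkord.
  apply: eq_bigr => i _; rewrite /= /mscale /= ger0_norm //.
  by apply: m0; apply/set_mem; rewrite -in_fset_set // mem_nth.
have mu1 : mu setT = 1.
  rewrite muE; under eq_fsbigr do rewrite diracT mule1.
  by rewrite fsumEFin // m1.
pose P := HB.pack_for (probability T R) mu
  (Measure_isProbability.Build _ _ _ mu mu1).
exists P; split=> [|t Zt]; rewrite [LHS]muE.
  by rewrite fsbig1 // => t Zt; rewrite diracE memNset ?mule0//= => /(_ Zt).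
rewrite (fsbigD1 t) //= diracE mem_set // mule1 fsbig1 ?adde0// => x [_ /= xt].
by rewrite diracE memNset ?mule0.
Qed.

End finite_support.

(** * Convex hulls of finite families *)

Section hull.
Context (R : realFieldType) (M : lmodType R).

Lemma convex_setP (A : set M) : convex_set A <->
  forall x y p, A x -> A y -> 0 <= p -> p <= 1 -> A (p *: x + (1 - p) *: y).
Proof.
split=> [cA x y p Ax Ay p0 p1|cA x y p /set_mem Ax /set_mem Ay]; last first.
  by apply/mem_set; apply: cA.
by have /set_mem := cA x y (Itv01 p0 p1) (mem_set Ax) (mem_set Ay).
Qed.

(** Leaving the weights unnormalised lets the induction on [s] apply to the tail, whose total weight
    is arbitrary. *)
Lemma convex_sum (A : set M) (I : eqType) (s : seq I) (w : I -> R)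
    (f : I -> M) :
  convex_set A -> (forall i, i \in s -> 0 <= w i) ->
  (forall i, i \in s -> A (f i)) -> 0 < \sum_(i <- s) w i ->
  A ((\sum_(i <- s) w i)^-1 *: \sum_(i <- s) w i *: f i).
Proof.
move=> /convex_setP cA; elim: s => [|i s IH] w0 Af.
  by rewrite big_nil ltxx.
have w0s j : j \in s -> 0 <= w j by move=> js; apply: w0; rewrite inE js orbT.
have wi : 0 <= w i by apply: w0; rewrite mem_head.
have Ai : A (f i) by apply: Af; rewrite mem_head.
rewrite !big_cons; set S := \sum_(j <- s) w j.
have := erefl S; rewrite {2}/S => SE.
have S0 : 0 <= S by rewrite /S big_seq; exact: sumr_ge0.
(* If the tail has total weight 0, all its weights vanish and the combination is [f i]. Otherwise
   [f i] and the normalised tail are mixed in proportion [w i] to [S]. *)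
move=> W0; have [S00|Sgt0] := eqVneq S 0.
  have -> : \sum_(j <- s) w j *: f j = 0.
    rewrite big_seq big1 // => j js.
    move: S00; rewrite SE big_seq => /eqP.
    rewrite psumr_eq0; last by move=> k /w0s.
    move=> /allP/(_ j js); rewrite js /= => /eqP ->.
    by rewrite scale0r.
  by rewrite S00 !addr0 in W0 *; rewrite scalerA mulVf ?gt_eqF // scale1r.
have {}Sgt0 : 0 < S by rewrite lt_def Sgt0.
have As : A (S^-1 *: \sum_(j <- s) w j *: f j).
  by apply: IH => // j js; apply: Af; rewrite inE js orbT.
have := cA _ _ (w i / (w i + S)) Ai As.
rewrite scalerA scalerDr scalerA -/S mulrC.
have -> : (1 - (w i + S)^-1 * w i) / S = (w i + S)^-1.
  by field; rewrite !gt_eqF.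
by apply; rewrite ?mulr_ge0 ?invr_ge0 ?(ltW W0) // ler_pdivrMl // mulr1 lerDl.
Qed.

(** The weighted combinations form a convex set containing the image of [Z], so the hull lies inside
    it; [convex_sum] gives the reverse inclusion. *)
Lemma convex_hull_finite (T : choiceType) (Z : set T) (f : T -> M) (z : M) :
  finite_set Z ->
  convex_hull (f @` Z) z <->
  exists m : T -> R, [/\ forall t, Z t -> 0 <= m t,
    \sum_(t \in Z) m t = 1 & z = \sum_(t \in Z) m t *: f t].
Proof.
move=> Zfin; split=> [|[m [m0 m1 ->]] C [cC ZC]]; last first.
  rewrite !fsbig_finite // in m1 *.
  rewrite -[X in C X]scale1r -[1]invr1 -m1; apply: convex_sum => //.
  - by move=> t; rewrite in_fset_set // => /set_mem/m0.
  - by move=> t; rewrite in_fset_set // => /set_mem Zt; apply: ZC; exists t.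
  - by rewrite m1.
pose A := [set x | exists m : T -> R, [/\ forall t, Z t -> 0 <= m t,
  \sum_(t \in Z) m t = 1 & x = \sum_(t \in Z) m t *: f t]].
move=> /(_ A); apply; split=> [|_ [t Zt <-]].
  apply/convex_setP => x y p [m [m0 m1 ->]] [n [n0 n1 ->]] p0 p1.
  exists (fun t => p * m t + (1 - p) * n t); split=> [t Zt /=||].
  - by rewrite /= addr_ge0 //; apply: mulr_ge0; rewrite ?subr_ge0 ?m0 ?n0.
  - by rewrite fsbig_split //= -!mulr_fsumr m1 n1 !mulr1 subrKC.
  - rewrite !fsbig_finite //= !scaler_sumr -big_split /=.
    by apply: eq_bigr => t _; rewrite !scalerA -scalerDl.
exists (fun s => (s == t)%:R); split=> [s _||]; first by rewrite ler0n.
- by rewrite (fsbigD1 t) //= eqxx fsbig1 ?addr0 // => s [_ /= /eqP/negbTE ->].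
- rewrite (fsbigD1 t) //= eqxx scale1r fsbig1 ?addr0 // => s [_ /= /eqP st].
  by rewrite (negbTE st) scale0r.
Qed.

End hull.

(** * Borel structure of the circle and the order parameter *)

Section measurability.
Variable R : realType.
Local Open Scope quotient_scope.

Lemma open_measurable_circle (A : set (circle R)) : open A -> measurable A.
Proof. exact: sub_gen_smallest. Qed.

Lemma continuous_on_circle (f : R -> R) :
  periodic f (pi *+ 2) -> continuous f ->
  continuous (on_circle f : circle R -> R).
Proof.
move=> fp fc; apply/quotient_continuous.
rewrite [X in continuous X](_ : _ = f) //.
by apply/funext => t; exact: on_circleE.
Qed.

Lemma measurable_on_circle (f : R -> R) :
  periodic f (pi *+ 2) -> continuous f ->
  measurable_fun [set: circle R] (on_circle f).
Proof.
move=> fp fc; apply: (measurability _ (RGenOpens.measurableE R)).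
move=> _ [_ [a [b ->] <-]]; rewrite setTI; apply: open_measurable_circle.
have /continuousP := continuous_on_circle fp fc; apply; exact: interval_open.
Qed.

(** A point is the intersection of a fibre of cosine with a fibre of sine, both closed by continuity
    on the quotient. *)
Lemma measurable_circle_set1 (zeta : circle R) : measurable [set zeta].
Proof.
have c_c := continuous_on_circle (@cosD2pi R) (@continuous_cos R).
have c_s := continuous_on_circle (@sinD2pi R) (@continuous_sin R).
have -> : [set zeta] = on_circle (@cos R) @^-1` [set cos (repr zeta)] `&`
    on_circle (@sin R) @^-1` [set sin (repr zeta)].
  apply/seteqP; split=> [_ -> //|xi [/= ec es]].
  apply: on_circle_cis_inj; move: ec es.
  by rewrite /on_circle /= /cis => -> ->.
have meas (f : circle R -> R) x : continuous f -> measurable (f @^-1` [set x]).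
  move=> fc; rewrite -[X in measurable X]setCK; apply: measurableC.
  apply: open_measurable_circle; rewrite openC.
  by apply: (@preimage_closed _ _ f [set x]) => [t _|];
    [exact: fc | exact: closed_eq].
by apply: measurableI; exact: meas.
Qed.

Lemma order_parameter_finite_support (rho : probability (circle R) R) Z :
  finite_set Z -> supported_on rho Z ->
  order_parameter rho =
    \sum_(zeta \in Z) fine (rho [set zeta]) *: on_circle (@cis R) zeta.
Proof.
move=> Zfin rhoZ; rewrite /order_parameter.
rewrite (finite_support_integral measurable_circle_set1 Zfin rhoZ); last first.
  exact: measurable_on_circle (@cosD2pi R) (@continuous_cos R).
rewrite (finite_support_integral measurable_circle_set1 Zfin rhoZ); last first.
  exact: measurable_on_circle (@sinD2pi R) (@continuous_sin R).
rewrite !fsbig_finite //=; elim: (enum_fset (fset_set Z)) => [|x s IH].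
  by rewrite !big_nil.
by rewrite !big_cons -IH.
Qed.

End measurability.

Theorem lemma4p3 (R : realType) (z1 : Rcomplex R) (arg_z1 K Ks : R)
    (harg : is_arg z1 arg_z1) (hKs : 0 < Ks) :
  let Z := zero_set z1 arg_z1 K Ks in
  [/\ finite_set Z,
      (exists rho : probability (circle R) R,
          supported_on rho Z /\ z1 = order_parameter rho) <->
        convex_hull (on_circle (@cis R) @` Z) z1
    & forall rho : probability (circle R) R,
        supported_on rho Z -> z1 = order_parameter rho ->
        exists m : circle R -> R,
          [/\ forall zeta, Z zeta -> 0 <= m zeta,
              \sum_(zeta \in Z) m zeta = 1,
              forall A : set (circle R), measurable A ->
                rho A = (\sum_(zeta \in Z) (m zeta)%:E * \d_zeta A)%E
            & z1 = \sum_(zeta \in Z) m zeta *: on_circle (@cis R) zeta]].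
Proof.
move=> Z.
have Zfin : finite_set Z by exact: finite_zero_set.
have mset1 := @measurable_circle_set1 R.
(* The masses of the atoms serve as weights. This is part (2), and it also yields the forward
   implication of part (1). *)
have weights (rho : probability (circle R) R) :
    supported_on rho Z -> z1 = order_parameter rho ->
    exists m : circle R -> R,
      [/\ forall zeta, Z zeta -> 0 <= m zeta,
          \sum_(zeta \in Z) m zeta = 1,
          forall A : set (circle R), measurable A ->
            rho A = (\sum_(zeta \in Z) (m zeta)%:E * \d_zeta A)%E
        & z1 = \sum_(zeta \in Z) m zeta *: on_circle (@cis R) zeta].
  move=> rhoZ z1E; exists (fun zeta => fine (rho [set zeta])).
  have rhoE A : measurable A ->
      rho A = (\sum_(zeta \in Z) (fine (rho [set zeta]))%:E * \d_zeta A)%E.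
    move=> mA; rewrite (finite_support_measureE mset1 Zfin rhoZ mA).
    by apply: eq_fsbigr => zeta _; rewrite fineK // fin_num_measure.
  split=> //.
  - by move=> zeta _; rewrite fine_ge0.
  - apply: EFin_inj; rewrite -fsumEFin // -(probability_setT rho) rhoE //.
    by apply: eq_fsbigr => zeta _; rewrite diracT mule1.
  - by rewrite z1E (order_parameter_finite_support Zfin rhoZ).
split=> //; rewrite convex_hull_finite //; split=> [[rho [rhoZ z1E]]|].
  by have [m [m0 m1 _ mE]] := weights rho rhoZ z1E; exists m.
(* Conversely, hull weights define a probability on [Z] whose atoms have exactly these masses, so
   its order parameter is the given combination. *)
move=> [m [m0 m1 ->]].
have [rho [rhoZ rhoE]] := probability_of_weights Zfin m0 m1.
have suppZ : supported_on rho Z.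
  apply/negligibleP => //; apply: measurableC.
  exact/countable_measurable/finite_set_countable.
exists rho; split=> //; rewrite (order_parameter_finite_support Zfin suppZ).
by apply: eq_fsbigr => zeta /set_mem Zzeta; rewrite rhoE.
Qed.
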